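(* Let $x_1,\dots,x_n$ be independent samples of a mean-zero sub-Gaussian distribution on $\mathbb{R}^d$ (with $O(1)$ sub-Gaussian constant) with covariance $\Sigma$, $\|\Sigma\|_{\mathrm{op}}\le1$, and suppose $n\ge d(\log d)^{C_0}$ for a sufficiently large absolute constant $C_0$. Then with probability at least $1-n^{-\omega(1)}$, $\Big\|\sum_{i=1}^n(x_i\otimes x_i)(x_i\otimes x_i)^\top\Big\|_{\mathrm{op}}=O(nd).$
   Context: $x\otimes x\in\mathbb{R}^{d^2}$ is the Kronecker (tensor) product. *)

(* Defs.v *)
From HB Require Import structures.
From mathcomp Require Import all_boot all_order all_algebra.
From mathcomp Require Import all_classical all_reals all_analysis.
Set Implicit Arguments.
Unset Strict Implicit.
Unset Printing Implicit Defensive.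
Import Order.TTheory GRing.Theory Num.Theory.
Import numFieldNormedType.Exports.
Local Open Scope classical_set_scope.
Local Open Scope ring_scope.

Section Defs.
Variable R : realType.

Definition dotv d (x y : 'cV[R]_d) : R := \sum_(j < d) x j 0 * y j 0.
Definition norm2 d (x : 'cV[R]_d) : R := Num.sqrt (dotv x x).

Definition opnorm m p (A : 'M[R]_(m, p)) : R :=
  sup [set norm2 (A *m u) | u in [set u : 'cV[R]_p | norm2 u <= 1]].

(* Kronecker product x (x) y in R^(d*d), entry (i,j) at index i*d+j *)
Definition kronv d (x y : 'cV[R]_d) : 'cV[R]_(d * d) := (mxvec (x *m y^T))^T.

Variables (dsp : measure_display) (T : measurableType dsp).

Definition covmx d (P : probability T R) (x : T -> 'cV[R]_d) : 'M[R]_d :=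
  \matrix_(j, k) fine (\int[P]_w (x w j 0 * x w k 0)%:E)%E.

Definition mean_zero d (P : probability T R) (x : T -> 'cV[R]_d) : Prop :=
  forall j : 'I_d, P.-integrable setT (fun w => (x w j 0)%:E) /\
    (\int[P]_w (x w j 0)%:E = 0)%E.

(* sub-Gaussian with constant K: psi_2 norm of every one-dimensional
   marginal <x,u>, |u| = 1, is at most K, i.e. E exp(<x,u>^2/K^2) <= 2 *)
Definition subgaussian d (P : probability T R) (K : R) (x : T -> 'cV[R]_d) : Prop :=
  forall u : 'cV[R]_d, norm2 u = 1 ->
    (\int[P]_w (expR ((dotv (x w) u) ^+ 2 / K ^+ 2))%:E <= 2%:E)%E.

(* mutual independence of the random vectors X_0, ..., X_{n-1}
   (product rule on the generating pi-systems of measurable rectangles) *)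
Definition mutually_indep n d (P : probability T R) (X : 'I_n -> T -> 'cV[R]_d) : Prop :=
  forall B : 'I_n -> 'I_d -> set R, (forall i j, measurable (B i j)) ->
    fine (P [set w | forall i j, B i j (X i w j 0)]) =
    \prod_(i < n) fine (P [set w | forall j, B i j (X i w j 0)]).

Definition ident_distr n d (P : probability T R) (X : 'I_n -> T -> 'cV[R]_d) : Prop :=
  forall (i i' : 'I_n) (B : 'I_d -> set R), (forall j, measurable (B j)) ->
    P [set w | forall j, B j (X i w j 0)] = P [set w | forall j, B j (X i' w j 0)].

End Defs.

(* Main.v *)
(** Write the quadratic form of the matrix at u as the sum of (x_i^T M x_i)^2,
    where M is u reshaped as a d x d matrix.  Each term is at most
    |x_i|^2 |M x_i|^2, so the indices with |x_i|^2 = O(d) contribute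
    O(d) |sum_i x_i x_i^T| |M|_F^2, and the others at most
    |M|_F^2 times the truncated sum of the |x_i|^4 with |x_i|^2 > c d.
    A net of 64^d vectors and Chernoff's bound give |sum_i x_i x_i^T| = O(n).
    With overwhelming probability all |x_i|^2 are O(d + A log n); on that event
    the truncated fourth powers have exponential moments at the scale
    1/(d + A log n), and since the part above c d has mean O(1), a second
    Chernoff bound gives O(nd), with a constant independent of A. *)
Require Import Defs.
From HB Require Import structures.
From mathcomp Require Import all_boot all_order all_algebra.
From mathcomp Require Import all_classical all_reals all_analysis.
From mathcomp Require Import measurable_realfun ring lra.
Import Order.TTheory GRing.Theory Num.Theory.
Local Open Scope classical_set_scope.
Local Open Scope ring_scope.

(** * Independence *)
Section independence.
Context {dsp : measure_display} {T : measurableType dsp} {R : realType}.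
Variable P : probability T R.
Local Open Scope ereal_scope.

(** Dynkin's pi-lambda argument: the sets satisfying the product formula against the weight [W] form
    a lambda-system containing the pi-system [G]. In the application [W] is the product of the other
    independent factors. *)
Lemma indep_sets_sigma (G : set (set T)) (W : T -> R) :
  setI_closed G -> G `<=` measurable -> G setT ->
  measurable_fun setT W -> (forall x, 0 <= W x)%R ->
  \int[P]_x (W x)%:E < +oo ->
  (forall A, G A -> \int[P]_x (\1_A x * W x)%:E = P A * \int[P]_x (W x)%:E) ->
  forall A, <<s G >> A -> measurable A /\
    \int[P]_x (\1_A x * W x)%:E = P A * \int[P]_x (W x)%:E.
Proof.
move=> GI Gm GT mW W0 Woo GW.
set c := \int[P]_x (W x)%:E.
have c_fin : c \is a fin_num.
  by rewrite ge0_fin_numE// integral_ge0// => x _; rewrite lee_fin.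
have W1 A x : (0 <= \1_A x * W x)%R by rewrite mulr_ge0.
have mW1 A : measurable A -> measurable_fun setT (EFin \o (fun x => \1_A x * W x : R)%R).
  by move=> mA; apply/measurable_EFinP; apply: measurable_funM.
pose H := [set A | measurable A /\ \int[P]_x (\1_A x * W x)%:E = P A * c].
suff: <<s setT, G >> `<=` H by [].
apply: lambda_system_subset => //; last by move=> A GA; split; [exact: Gm|exact: GW].
split => //.
- by split; [exact: Gm|exact: GW].
- move=> A B BA [mA EA] [mB EB]; have mAB : measurable (A `\` B) by exact: measurableD.
  split => //.
  have BAD : B `|` (A `\` B) = A by apply: setDUK.
  have BdAB : B `&` (A `\` B) = set0 by rewrite setICA setICr setI0.
  have PA : P A = P (A `\` B) + P B.
    by rewrite -[in LHS]BAD measureU// addeC.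
  have IA : \int[P]_x (\1_A x * W x)%:E =
      \int[P]_x (\1_(A `\` B) x * W x)%:E + \int[P]_x (\1_B x * W x)%:E.
    rewrite -ge0_integralD//; first last.
    - exact: mW1.
    - by move=> x _; rewrite lee_fin.
    - exact: mW1.
    - by move=> x _; rewrite lee_fin.
    apply: eq_integral => x _; rewrite -EFinD -mulrDl; congr (_ * _)%:E%R.
    rewrite -[in LHS]BAD !indicE in_setU.
    have : ~ (x \in B /\ x \in A `\` B).
      by rewrite !inE => -[xB [_]].
    case: (x \in B) (x \in A `\` B) => -[]//=; rewrite ?addr0 ?add0r//.
    by move=> /(_ (conj erefl erefl)).
  (* Proper differences are handled by cancelling this term, so it has to be finite. *)
  have fB : P B * c \is a fin_num by rewrite fin_numM// fin_num_measure.
  rewrite -[LHS](addeK _ fB) -[RHS](addeK _ fB); congr (_ - _).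
  by rewrite -[X in _ + X = _]EB -IA EA PA muleDl// fin_num_adde_defr// fin_num_measure.
- move=> F ndF HF.
  have mF n : measurable (F n) by have [] := HF n.
  have mUF : measurable (\bigcup_n F n) by exact: bigcupT_measurable.
  split => //.
  have cP : (P (F n) * c) @[n --> \oo] --> P (\bigcup_n F n) * c.
    by apply: cvgeZr => //; exact: nondecreasing_cvg_mu.
  have cI : \int[P]_x (\1_(F n) x * W x)%:E @[n --> \oo]
            --> \int[P]_x (\1_(\bigcup_n F n) x * W x)%:E.
    rewrite [X in _ --> X](_ : _ = \int[P]_x
        (limn (fun n => (\1_(F n) x * W x)%:E))).
      apply: cvg_monotone_convergence => //.
      - by move=> n; exact: mW1.
      - by move=> n x _; rewrite lee_fin.
      - move=> x _ m n mn; rewrite lee_fin ler_wpM2r// !indicE.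
        have /subsetPset FF := ndF _ _ mn.
        case: (boolP (x \in F m)) => // /[!inE] xF.
        by rewrite mem_set//; exact: FF.
    apply: eq_integral => x _; apply/esym/cvg_lim => //.
    have [xF|xF] := boolP (x \in \bigcup_n F n).
      move: (xF); rewrite inE => -[N _ xN].
      rewrite indicE xF; apply: cvg_near_cst; exists N => // n /= Nn.
      have /subsetPset FF := ndF _ _ Nn.
      by rewrite indicE mem_set//; exact: FF.
    rewrite indicE (negbTE xF); apply: cvg_near_cst; exists 0%N => // n /= _.
    rewrite indicE memNset// => xn.
    by move: xF; rewrite notin_setE; apply; exists n.
  apply: (cvg_unique _ cI) => //.
  rewrite (_ : (fun n => _) = (fun n => P (F n) * c))//.
  by apply/funext => n; have [_ ->] := HF n.
Qed.

Import HBNNSimple.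

(** Simple functions increase to [h]: linearity reduces each of them to its level sets, and monotone
    convergence passes to the limit on both sides. *)
Lemma indep_fun_sigma (G : set (set T)) (h W : T -> R) :
  setI_closed G -> G `<=` measurable -> G setT ->
  measurable_fun setT W -> (forall x, 0 <= W x)%R ->
  \int[P]_x (W x)%:E < +oo ->
  (forall A, G A -> \int[P]_x (\1_A x * W x)%:E = P A * \int[P]_x (W x)%:E) ->
  measurable_fun setT (h : g_sigma_algebraType G -> R) ->
  (forall x, 0 <= h x)%R ->
  \int[P]_x (h x * W x)%:E = \int[P]_x (h x)%:E * \int[P]_x (W x)%:E.
Proof.
move=> GI Gm GT mW W0 Woo GW mh h0.
have sG := indep_sets_sigma _ _ GI Gm GT mW W0 Woo GW.
set c := \int[P]_x (W x)%:E in sG *.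
have c_fin : c \is a fin_num.
  by rewrite ge0_fin_numE// integral_ge0// => x _; rewrite lee_fin.
have mhE : measurable_fun setT (EFin \o (h : g_sigma_algebraType G -> R)).
  by apply/measurable_EFinP.
(* The approximants live on the sigma-algebra generated by [G], so that [sG] applies to their level
   sets. *)
pose s n : {nnsfun (g_sigma_algebraType G) >-> R} := nnsfun_approx measurableT mhE n.
have sGm (A : set T) : <<s G >> A -> measurable A by case/sG.
have mpre n y : <<s G >> (s n @^-1` [set y]).
  have : measurable ((s n : g_sigma_algebraType G -> R) @^-1` [set y]).
    by rewrite -[X in measurable X]setTI; exact: measurable_funP.
  by [].
have msn n : measurable_fun setT (s n : T -> R).
  move=> _ B mB; rewrite setTI; apply: sGm.
  have : measurable ((s n : g_sigma_algebraType G -> R) @^-1` B).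
    by rewrite -[X in measurable X]setTI; exact: measurable_funP.
  by [].
have cs x : (s n x)%:E @[n --> \oo] --> (h x)%:E.
  apply: (@cvg_nnsfun_approx _ _ _ setT measurableT _ mhE) => //.
  by move=> y _; rewrite lee_fin.
have nds x m n : (m <= n)%N -> (s m x <= s n x)%R.
  by move=> mn; exact/lefP/nd_nnsfun_approx.
have keyc n : \int[P]_x (s n x * W x)%:E = \int[P]_x (s n x)%:E * c.
  pose fs := finmap.enum_fset (fset_set (range (s n))).
  pose y (i : 'I_(size fs)) := (fs`_i)%R.
  pose A (i : 'I_(size fs)) : set T := s n @^-1` [set y i].
  have y0 i : (0 <= y i)%R.
    have : y i \in fs by rewrite /y mem_nth.
    have -> : (y i \in fs) = (y i \in range (s n)).
      by rewrite -in_fset_set.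
    by rewrite inE => -[x _ <-].
  have sE x : s n x = (\sum_i y i * \1_(A i) x)%R by exact: fimfunEord.
  have mA i : measurable (A i) by apply: sGm; exact: mpre.
  (* Used twice, with [V = W] and with [V = 1]. *)
  have key (V : T -> R) : measurable_fun setT V -> (forall x, 0 <= V x)%R ->
      \int[P]_x (s n x * V x)%:E =
      \sum_i ((y i)%:E * \int[P]_x (\1_(A i) x * V x)%:E).
    move=> mV V0.
    have mAV i : measurable_fun setT (EFin \o (fun x => \1_(A i) x * V x)%R).
      by apply/measurable_EFinP/measurable_funM.
    under eq_integral => x _.
      rewrite sE mulr_suml -sumEFin; under eq_bigr do rewrite -mulrA EFinM; over.
    rewrite ge0_integral_sum//.
    - apply: eq_bigr => i _; rewrite ge0_integralZl//.
      + exact: mAV.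
      + by move=> x _; rewrite lee_fin mulr_ge0.
      + by rewrite lee_fin.
    - by move=> i; apply: measurable_funeM; exact: mAV.
    - by move=> i x _; rewrite mule_ge0// lee_fin// mulr_ge0.
  have key1 := key (cst 1%R) (@measurable_cst _ _ _ _ _ _) (fun=> ler01).
  under [in RHS]eq_integral do rewrite -[s n _]mulr1.
  rewrite key// key1 ge0_sume_distrl; last first.
    move=> i _; rewrite mule_ge0// ?lee_fin//.
    by apply: integral_ge0 => x _; rewrite lee_fin mulr1.
  apply: eq_bigr => i _; rewrite -muleA; congr (_ * _).
  have [_ ->] := sG _ (mpre n (y i)); congr (_ * _).
  under eq_integral do rewrite mulr1.
  by rewrite integral_indic// setIT.
have c1 : \int[P]_x (s n x * W x)%:E @[n --> \oo] --> \int[P]_x (h x * W x)%:E.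
  rewrite [X in _ --> X](_ : _ = \int[P]_x (limn (fun n => (s n x * W x)%:E))).
    apply: cvg_monotone_convergence => //.
    - by move=> n; apply/measurable_EFinP/measurable_funM.
    - by move=> n x _; rewrite lee_fin mulr_ge0.
    - by move=> x _ m n mn; rewrite lee_fin ler_wpM2r// nds.
  apply: eq_integral => x _; apply/esym/cvg_lim => //.
  have : (s n x)%:E * (W x)%:E @[n --> \oo] --> (h x)%:E * (W x)%:E.
    by apply: cvgeZr.
  by [].
have c2 : \int[P]_x (s n x)%:E @[n --> \oo] --> \int[P]_x (h x)%:E.
  rewrite [X in _ --> X](_ : _ = \int[P]_x (limn (fun n => (s n x)%:E))).
    apply: cvg_monotone_convergence => //.
    - by move=> n; apply/measurable_EFinP.
    - by move=> n x _; rewrite lee_fin.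
    - by move=> x _ m n mn; rewrite lee_fin nds.
  by apply: eq_integral => x _; apply/esym/cvg_lim.
apply: (cvg_unique _ c1) => //.
rewrite (_ : (fun n => _) = (fun n => \int[P]_x (s n x)%:E * c)).
  exact: cvgeZr.
by apply/funext => n; exact: keyc.
Qed.

Lemma integral_prod_indep n (G : 'I_n -> set (set T)) (h : 'I_n -> T -> R)
    (a : 'I_n -> R) :
  (forall i, [/\ setI_closed (G i), G i `<=` measurable & G i setT]) ->
  (forall A : 'I_n -> set T, (forall i, G i (A i)) ->
    P [set x | forall i, A i x] = (\prod_i fine (P (A i)))%:E) ->
  (forall i, measurable_fun setT (h i : g_sigma_algebraType (G i) -> R)) ->
  (forall i x, 0 <= h i x)%R ->
  (forall i, \int[P]_x (h i x)%:E = (a i)%:E) ->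
  \int[P]_x (\prod_i h i x)%:E = (\prod_i a i)%:E.
Proof.
move=> GP GI.
have sG i (A : set T) : <<s G i >> A -> measurable A.
  have [_ Gm _] := GP i.
  exact: (smallest_sub (@sigma_algebra_measurable _ T) Gm).
(* Induction on the number k of leading factors that are arbitrary functions;
   the remaining ones are indicators of generators. *)
suff H k : (k <= n)%N -> forall (h : 'I_n -> T -> R) (a : 'I_n -> R),
    (forall i, measurable_fun setT (h i : g_sigma_algebraType (G i) -> R)) ->
    (forall i x, 0 <= h i x)%R ->
    (forall i, \int[P]_x (h i x)%:E = (a i)%:E) ->
    (forall i : 'I_n, (k <= i)%N -> exists2 A, G i A & h i = \1_A) ->
    \int[P]_x (\prod_i h i x)%:E = (\prod_i a i)%:E.
  move=> mh h0 ha; apply: (H n) => // i ni.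
  by have := ltn_ord i; rewrite ltnNge ni.
elim: k => [_|k IH kn] {}h {}a mh h0 ha hk.
  have /choice[A GA] : forall i, exists A, G i A /\ h i = \1_A.
    by move=> i; have [A] := hk i (leq0n _); exists A.
  have mA i : measurable (A i) by apply: (sG i); apply: sub_sigma_algebra; case: (GA i).
  have -> : (\prod_i a i = \prod_i fine (P (A i)))%R.
    apply: eq_bigr => i _; have := ha i; have [_ ->] := GA i.
    by rewrite integral_indic// setIT => ->.
  rewrite -GI; last by move=> i; case: (GA i).
  have mI : measurable [set x | forall i, A i x].
    rewrite (_ : mkset _ = \bigcap_(i in [set: 'I_n]) A i).
      by apply: fin_bigcap_measurable => //; exact: finite_finset.
    by apply/seteqP; split => [x /= Ax i _|x Ax i]; exact: Ax.
  rewrite -[in RHS](setIT (mkset _)) -integral_indic//; apply: eq_integral => x _.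
  congr EFin; rewrite indicE; have [xA|xA] := boolP (x \in _).
    rewrite big1// => i _; have [_ ->] := GA i.
    by rewrite indicE mem_set//; move: xA; rewrite inE; apply.
  have [i Ai] : exists i, ~ A i x.
    by apply/existsNP => Ax; move: xA; rewrite notin_setE; apply.
  rewrite (bigD1 i)//=; have [_ ->] := GA i.
  by rewrite indicE memNset// mul0r.
pose i0 := Ordinal kn.
pose W x := (\prod_(i | i != i0) h i x)%R.
pose b := (\prod_(i | i != i0) a i)%R.
have [GI0 Gm0 GT0] := GP i0.
(* The induction hypothesis, with factor [i0] replaced by the indicator of [A], gives the product
   formula on generators that [indep_fun_sigma] asks for. *)
have HA A : G i0 A -> \int[P]_x (\1_A x * W x)%:E = P A * b%:E.
  move=> GA; pose h' i := if i == i0 then \1_A else h i.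
  pose a' i := if i == i0 then fine (P A) else a i.
  have mA : measurable A by exact: Gm0.
  have := IH (ltnW kn) h' a'.
  have Eh x : (\prod_i h' i x = \1_A x * W x)%R.
    rewrite (bigD1 i0)//= [h' i0]ifT//; congr (_ * _)%R.
    by apply: eq_bigr => i /negbTE ii0; rewrite /h' ii0.
  have Ea : (\prod_i a' i = fine (P A) * b)%R.
    rewrite (bigD1 i0)//= [a' i0]ifT//; congr (_ * _)%R.
    by apply: eq_bigr => i /negbTE ii0; rewrite /a' ii0.
  under eq_integral do rewrite Eh.
  rewrite Ea EFinM fineK ?fin_num_measure//; apply.
  - move=> i; rewrite /h'; case: eqP => [->|_]; last exact: mh.
    by apply: measurable_indic; apply: sub_sigma_algebra.
  - by move=> i x; rewrite /h'; case: eqP.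
  - move=> i; rewrite /h' /a'; case: eqP => // _.
    by rewrite integral_indic// setIT fineK// fin_num_measure.
  - move=> i ki; rewrite /h'; case: eqP => [->|ii0]; first by exists A.
    by apply: hk; rewrite ltn_neqAle ki andbT; apply/eqP => E; apply/ii0/val_inj.
have Wb : \int[P]_x (W x)%:E = b%:E.
  have := HA _ GT0; rewrite probability_setT mul1e => <-.
  by apply: eq_integral => x _; rewrite indicT mul1r.
under eq_integral do rewrite (bigD1 i0)//= -/(W _).
rewrite [in RHS](bigD1 i0)//= -/b EFinM -ha -Wb.
apply: (@indep_fun_sigma (G i0)) => //.
- rewrite /W; under eq_fun do rewrite -big_filter.
  apply: measurable_prod => i _ _ B mB; rewrite setTI; apply: (sG i).
  by have := mh i measurableT B mB; rewrite setTI.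
- by move=> x; apply: prodr_ge0.
- by rewrite Wb ltry.
- by move=> A GA; rewrite Wb HA.
Qed.

(** The pi-system on which [mutually_indep] states its product rule. It generates the sigma-algebra
    of [x], so measurability for the latter expresses being a function of [x]. *)
Definition cylinders {d} (x : T -> 'cV[R]_d) : set (set T) :=
  [set A | exists2 B : 'I_d -> set R, (forall j, measurable (B j)) &
    A = [set w | forall j, B j (x w j 0%R)]].

Lemma measurable_coord_cylinders d (x : T -> 'cV[R]_d) (j : 'I_d) :
  measurable_fun setT ((fun w => x w j 0%R) : g_sigma_algebraType (cylinders x) -> R).
Proof.
move=> _ B mB; rewrite setTI; apply: sub_sigma_algebra.
exists (fun k => if k == j then B else setT).
  by move=> k; case: eqP => // _; exact: measurableT.
apply/seteqP; split => w /= Bw.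
  by move=> k; case: eqP => // ->.
by have := Bw j; rewrite eqxx.
Qed.

(** The bound makes each integral finite, so [integral_prod_indep] applies to the exact values,
    which are then bounded factor by factor. Both Chernoff bounds rest on this. *)
Lemma integral_prod_mutually_indep_le n d (X : 'I_n -> T -> 'cV[R]_d)
    (h : 'I_n -> T -> R) (b : R) :
  (forall i j, measurable_fun setT (fun w => X i w j 0%R)) ->
  mutually_indep P X ->
  (forall i, measurable_fun setT (h i : g_sigma_algebraType (cylinders (X i)) -> R)) ->
  (forall i x, 0 <= h i x)%R ->
  (forall i, \int[P]_x (h i x)%:E <= b%:E) ->
  \int[P]_x (\prod_i h i x)%:E <= (b ^+ n)%:E.
Proof.
move=> mX indX mh h0 hb.
have hfin i : \int[P]_x (h i x)%:E \is a fin_num.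
  rewrite ge0_fin_numE; first by rewrite (le_lt_trans (hb i))// ltry.
  by apply: integral_ge0 => x _; rewrite lee_fin.
have mcyl (B : 'I_d -> set R) i : (forall j, measurable (B j)) ->
    measurable [set w | forall j, B j (X i w j 0%R)].
  move=> mB; rewrite (_ : mkset _ =
      \bigcap_(j in [set: 'I_d]) ((fun w => X i w j 0%R) @^-1` B j)).
    apply: fin_bigcap_measurable => [|j _]; first exact: finite_finset.
    by rewrite -[X in measurable X]setTI; exact: mX.
  by apply/seteqP; split => [x /= Ax j _|x Ax j]; exact: Ax.
rewrite (@integral_prod_indep n (fun i => cylinders (X i)) h
    (fun i => fine (\int[P]_x (h i x)%:E))) //.
- rewrite lee_fin -[n in (b ^+ n)%R]card_ord -prodr_const.
  apply: ler_prod => i _; apply/andP; split.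
    by apply: fine_ge0; apply: integral_ge0 => x _; rewrite lee_fin.
  by rewrite -lee_fin fineK.
- move=> i; split.
  + move=> A1 A2 [B1 mB1 ->] [B2 mB2 ->].
    exists (fun j => B1 j `&` B2 j); first by move=> j; exact: measurableI.
    apply/seteqP; split => w /=.
      by move=> [w1 w2] j; split; [exact: w1|exact: w2].
    by move=> w12; split => j; case: (w12 j).
  + by move=> A [B mB ->]; exact: mcyl.
  + by exists (fun=> setT) => //; apply/seteqP; split.
- move=> A cA.
  have /choice[B BP] : forall i, exists B : 'I_d -> set R,
      (forall j, measurable (B j)) /\ A i = [set w | forall j, B j (X i w j 0%R)].
    by move=> i; have [B mB E] := cA i; exists B.
  have AE : A = (fun i => [set w | forall j, B i j (X i w j 0%R)]).
    by apply/funext => i; case: (BP i).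
  rewrite AE /= -indX ?fineK//; last by move=> i j; have [mB _] := BP i; exact: mB.
  apply: fin_num_measure.
  rewrite (_ : mkset _ = \bigcap_(i in [set: 'I_n])
      [set w | forall j, B i j (X i w j 0%R)]).
    apply: fin_bigcap_measurable => [|i _]; first exact: finite_finset.
    by apply: mcyl => j; case: (BP i).
  by apply/seteqP; split => [x /= Ax i _|x Ax i]; exact: Ax.
- by move=> i; rewrite fineK.
Qed.

Lemma measurable_superlevel (f : T -> R) (t : R) : measurable_fun setT f ->
  measurable [set x | t < f x]%R.
Proof.
move=> mf; rewrite (_ : mkset _ = setT `&` f @^-1` `]t, +oo[); first exact: mf.
by rewrite setTI; apply/seteqP; split => x /=; rewrite in_itv/= andbT.
Qed.

Lemma exp_markov (f : T -> R) (t m : R) : measurable_fun setT f ->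
  \int[P]_x (expR (f x))%:E <= m%:E ->
  P [set x | t < f x]%R <= (m * expR (- t))%:E.
Proof.
move=> mf fm; set A := [set x | _].
have mA : measurable A by exact: measurable_superlevel.
have : (expR t)%:E * P A <= m%:E.
  apply: le_trans fm; rewrite -[A in P A]setIT -integral_indic// -ge0_integralZl//.
  - apply: ge0_le_integral => //.
    + by apply: measurable_funeM; apply/measurable_EFinP.
    + by apply/measurable_EFinP; exact: measurableT_comp.
    + move=> x _; rewrite -EFinM lee_fin indicE; have [/[!inE] xA|] := boolP (x \in A).
        by rewrite mulr1 ler_expR ltW.
      by rewrite mulr0 expR_ge0.
  - exact/measurable_EFinP.
have PA : P A \is a fin_num by exact: fin_num_measure.
rewrite -(fineK PA) -EFinM !lee_fin expRN ler_pdivlMr ?expR_gt0//.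
by rewrite mulrC.
Qed.

End independence.

(** * Quadratic forms *)

Section linear_algebra.
Context {R : realType}.

Lemma dotvC {d} (x y : 'cV[R]_d) : dotv x y = dotv y x.
Proof. by apply: eq_bigr => j _; rewrite mulrC. Qed.

Lemma dotvDr {d} (x y z : 'cV[R]_d) : dotv x (y + z) = dotv x y + dotv x z.
Proof. by rewrite -big_split; apply: eq_bigr => j _; rewrite mxE mulrDr. Qed.

Lemma dotvZr {d} (x y : 'cV[R]_d) a : dotv x (a *: y) = a * dotv x y.
Proof. by rewrite mulr_sumr; apply: eq_bigr => j _; rewrite mxE mulrCA. Qed.

Lemma dotvZl {d} (x y : 'cV[R]_d) a : dotv (a *: x) y = a * dotv x y.
Proof. by rewrite dotvC dotvZr dotvC. Qed.

Lemma dotvBr {d} (x y z : 'cV[R]_d) : dotv x (y - z) = dotv x y - dotv x z.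
Proof. by rewrite -scaleN1r dotvDr dotvZr mulN1r. Qed.

Lemma dotvBl {d} (x y z : 'cV[R]_d) : dotv (y - z) x = dotv y x - dotv z x.
Proof. by rewrite dotvC dotvBr !(dotvC x). Qed.

Lemma dotv_sumr {d} I (s : seq I) (x : 'cV[R]_d) (y : I -> 'cV[R]_d) :
  dotv x (\sum_(i <- s) y i) = \sum_(i <- s) dotv x (y i).
Proof.
elim: s => [|i s IH]; last by rewrite !big_cons dotvDr IH.
by rewrite !big_nil /dotv big1// => j _; rewrite mxE mulr0.
Qed.

Lemma dotv_ge0 {d} (x : 'cV[R]_d) : 0 <= dotv x x.
Proof. by apply: sumr_ge0 => j _; rewrite -expr2 sqr_ge0. Qed.

Lemma dotv_eq0 {d} (x : 'cV[R]_d) : dotv x x = 0 -> x = 0.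
Proof.
move=> /psumr_eq0P x0; apply/matrixP => i j; rewrite ord1 mxE.
by apply/eqP; rewrite -sqrf_eq0 expr2 x0// => k _; rewrite -expr2 sqr_ge0.
Qed.

Lemma norm2_le {d} (x : 'cV[R]_d) (a : R) : 0 <= a ->
  (norm2 x <= a) = (dotv x x <= a ^+ 2).
Proof.
by move=> a0; rewrite -{1}(ger0_norm a0) -sqrtr_sqr ler_sqrt// sqr_ge0.
Qed.

Lemma dotv_cauchy_schwarz {d} (x y : 'cV[R]_d) :
  dotv x y ^+ 2 <= dotv x x * dotv y y.
Proof.
have [->|y0] := eqVneq y 0.
  rewrite (_ : dotv x 0 = 0) ?expr0n/= ?mulr_ge0 ?dotv_ge0//.
  by rewrite /dotv big1// => j _; rewrite mxE mulr0.
have yy : 0 < dotv y y.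
  by rewrite lt_neqAle dotv_ge0 andbT eq_sym; apply: contra_neq y0 => /dotv_eq0.
(* This vector is [dotv y y] times the component of [x] orthogonal to [y]; its squared norm is
   [dotv y y] times the Gram determinant. *)
have := dotv_ge0 (dotv y y *: x - dotv x y *: y).
have -> : dotv (dotv y y *: x - dotv x y *: y) (dotv y y *: x - dotv x y *: y) =
    dotv y y * (dotv x x * dotv y y - dotv x y ^+ 2).
  by rewrite !(dotvBr, dotvBl) !(dotvZr, dotvZl) (dotvC y x); ring.
by rewrite pmulr_rge0// subr_ge0.
Qed.

Lemma dotv_outer {d} (a u : 'cV[R]_d) : a *m a^T *m u = dotv a u *: a.
Proof.
rewrite -mulmxA; apply/matrixP => i j; rewrite ord1 !mxE big_ord1 mulrC.
by congr (_ * _); rewrite !mxE; apply: eq_bigr => k _; rewrite !mxE.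
Qed.

(** No spectral theory is involved: for [v = A *m u], |v|^2 is the sum of <a_i,u><a_i,v>, and the
    inequality 2Bst <= B^2 s^2 + t^2 gives 2B|v|^2 <= B^3 + B|v|^2, hence |v| <= B. *)
Lemma opnorm_sum_outer_le {p} n (a : 'I_n -> 'cV[R]_p) (B : R) : 0 < B ->
  (forall u, \sum_i dotv (a i) u ^+ 2 <= B * dotv u u) ->
  opnorm (\sum_i (a i *m (a i)^T)) <= B.
Proof.
move=> B0 aB; set A := \sum_i _.
have AE u : A *m u = \sum_i dotv (a i) u *: a i.
  by rewrite mulmx_suml; apply: eq_bigr => i _; exact: dotv_outer.
apply: sup_le_ub.
  exists (norm2 (A *m 0)), 0 => //=.
  rewrite norm2_le// expr1n /dotv big1// => j _; by rewrite mxE mulr0.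
move=> _ [u /= + <-]; rewrite !norm2_le ?(ltW B0)// expr1n => u1.
set v := A *m u.
have vv : dotv v v = \sum_i dotv (a i) u * dotv (a i) v.
  rewrite {2}/v AE dotv_sumr; apply: eq_bigr => i _.
  by rewrite dotvZr (dotvC v).
have H : 2 * B * dotv v v <= B ^+ 3 + B * dotv v v.
  apply: (@le_trans _ _ (\sum_i (B ^+ 2 * dotv (a i) u ^+ 2 + dotv (a i) v ^+ 2))).
    rewrite vv mulr_sumr; apply: ler_sum => i _.
    by have := sqr_ge0 (B * dotv (a i) u - dotv (a i) v); nra.
  rewrite big_split /= lerD//; rewrite -mulr_sumr (exprSr B 2) ler_pM2l ?exprn_gt0//.
  by apply: le_trans (aB u) _; rewrite ler_piMr// ltW.
rewrite -(ler_pM2l B0) -exprS; lra.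
Qed.

Lemma dotv_kronv {d} (x : 'cV[R]_d) (U : 'cV[R]_(d * d)) :
  dotv (kronv x x) U = dotv x (vec_mx U^T *m x).
Proof.
transitivity ((mxvec (x *m x^T) *m (mxvec (vec_mx U^T))^T) 0 0).
  rewrite vec_mxK trmxK mxE; apply: eq_bigr => k _.
  by rewrite /kronv mxE.
rewrite -[x in mxvec (x *m _)]trmxK mxvec_dotmul trmxK -mulmxA mxE.
by apply: eq_bigr => k _; rewrite mxE.
Qed.

(** The squared Frobenius norm is split by rows so that a bound on vectors can be applied to each
    row. *)
Lemma dotv_vec_mx {d} (U : 'cV[R]_(d * d)) :
  dotv U U = \sum_r dotv (row r (vec_mx U^T))^T (row r (vec_mx U^T))^T.
Proof.
rewrite /dotv (reindex _ (curry_mxvec_bij _ _)) /= pair_bigA.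
by apply: eq_bigr => [[i j]] /= _; rewrite !mxE.
Qed.

(** Here [s] bounds the second-moment form, [alpha] separates short from long vectors, and [beta]
    dominates the fourth powers of the norms of the long ones. *)
Lemma quad_kronv_le {d n} (X : 'I_n -> 'cV[R]_d) (s alpha : R) (beta : 'I_n -> R) :
  0 <= alpha -> (forall i, 0 <= beta i) ->
  (forall u, \sum_i dotv (X i) u ^+ 2 <= s * dotv u u) ->
  (forall i, alpha < dotv (X i) (X i) -> dotv (X i) (X i) ^+ 2 <= beta i) ->
  forall U, \sum_i dotv (kronv (X i) (X i)) U ^+ 2 <=
    (alpha * s + \sum_i beta i) * dotv U U.
Proof.
move=> alpha0 beta0 Xs Xbeta U; set M := vec_mx U^T.
pose m r : 'cV[R]_d := (row r M)^T.
have UE : dotv U U = \sum_r dotv (m r) (m r) by exact: dotv_vec_mx.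
have ME i : dotv (M *m X i) (M *m X i) = \sum_r dotv (X i) (m r) ^+ 2.
  apply: eq_bigr => r _; rewrite -expr2; congr (_ ^+ 2).
  by rewrite !mxE; apply: eq_bigr => k _; rewrite !mxE mulrC.
have Mle i : dotv (M *m X i) (M *m X i) <= dotv (X i) (X i) * dotv U U.
  by rewrite ME UE mulr_sumr; apply: ler_sum => r _; exact: dotv_cauchy_schwarz.
apply: (@le_trans _ _ (\sum_i (alpha * (\sum_r dotv (X i) (m r) ^+ 2)
                               + beta i * dotv U U))).
  apply: ler_sum => i _; rewrite dotv_kronv -/M -ME.
  apply: le_trans (dotv_cauchy_schwarz _ _) _.
  have [xa|xa] := leP (dotv (X i) (X i)) alpha.
    rewrite -[leLHS]addr0 lerD ?mulr_ge0 ?dotv_ge0//.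
    by rewrite ler_wpM2r ?dotv_ge0.
  rewrite -[leLHS]add0r lerD ?mulr_ge0 ?dotv_ge0//.
  apply: (@le_trans _ _ (dotv (X i) (X i) ^+ 2 * dotv U U)).
    by rewrite expr2 -mulrA ler_wpM2l ?dotv_ge0.
  by rewrite ler_wpM2r ?dotv_ge0// Xbeta.
rewrite big_split /= -mulr_sumr -mulr_suml mulrDl lerD2r -mulrA ler_wpM2l//.
(* With the rows outside, the sum over the samples is at most [s] times the squared norm of each
   row. *)
by rewrite exchange_big UE mulr_sumr; apply: ler_sum.
Qed.

End linear_algebra.

(** * A net of the unit ball *)

Section net.
Context {R : realType} {d : nat}.

Definition net_index := {ffun 'I_d -> bool * 'I_(2 * d).+1}.

(* The net consists of the points of the grid of mesh 1 / (2 sqrt d) in the unit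
   ball; the boolean of an index is a sign and the ordinal an absolute value. *)
Definition in_net (f : net_index) := (\sum_j (f j).2 ^ 2 <= 4 * d)%N.

Definition net_point (f : net_index) : 'cV[R]_d :=
  \col_j ((-1) ^+ (f j).1 * ((f j).2)%:R / (2 * Num.sqrt d%:R)).

Lemma card_net : \sum_(f : net_index | in_net f) 1 <= 64 ^+ d :> R.
Proof.
(* Each index of the net has weight prod_j w (f j) at least 1. *)
pose w (p : bool * 'I_(2 * d).+1) : R := 16 * 2^-1 ^+ p.2.
have w0 p : 0 <= w p by rewrite mulr_ge0// exprn_ge0// invr_ge0.
have geom m : \sum_(k < m) (2^-1 : R) ^+ k = 2 - 2 * 2^-1 ^+ m.
  elim: m => [|m IH]; first by rewrite big_ord0 expr0; lra.
  by rewrite big_ord_recr /= IH exprSr; lra.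
(* Two signs, the factor 16 and a geometric series below 2 give 64. *)
have sw : \sum_p w p <= 64.
  rewrite -(pair_big xpredT xpredT (fun (b : bool) (k : 'I_(2 * d).+1) => w (b, k)))/=.
  rewrite big_bool /w /= -!mulr_sumr geom.
  have : 0 <= (2^-1 : R) ^+ (2 * d).+1 by rewrite exprn_ge0// invr_ge0.
  lra.
apply: (@le_trans _ _ (\sum_(f : net_index) \prod_j w (f j))).
  rewrite [leRHS](bigID in_net)/= -[leLHS]addr0 lerD//; last first.
    by apply: sumr_ge0 => f _; apply: prodr_ge0.
  apply: ler_sum => f fN; rewrite big_split /= prodr_const card_ord.
  rewrite (_ : \prod_j _ = 2^-1 ^+ (\sum_j (f j).2)%N); last first.
    by rewrite expr_sum.
  (* Since k <= k^2 for naturals, the power of 1/2 is at least 2^(-4d), which the factor 16^d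
     compensates. *)
  have le1 : (\sum_j (f j).2 <= 4 * d)%N.
    apply: leq_trans fN; apply: leq_sum => j _.
    by case: (nat_of_ord _) => // k; rewrite -mulnn leq_pmulr.
  rewrite exprVn -ler_pdivrMr ?invr_gt0 ?exprn_gt0// invrK mul1r.
  rewrite (_ : 16 = 2 ^+ 4 :> R); last by rewrite -natrX.
  by rewrite -exprM ler_weXn2l// ler1n.
rewrite -(bigA_distr_bigA (fun _ : 'I_d => w)) /= prodr_const card_ord.
by rewrite lerXn2r// nnegrE ?sumr_ge0.
Qed.

Lemma net_point_le1 f : (0 < d)%N -> in_net f -> dotv (net_point f) (net_point f) <= 1.
Proof.
move=> d0 fN; have dR : 0 < d%:R :> R by rewrite ltr0n.
rewrite /dotv (eq_bigr (fun j => ((f j).2 ^ 2)%N%:R / (4 * d%:R))); last first.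
  move=> j _; rewrite mxE -expr2 !exprMn sqrr_sign mul1r exprVn exprMn.
  by rewrite sqr_sqrtr ?ler0n// natrX; congr (_ / _); ring.
by rewrite -mulr_suml -natr_sum ler_pdivrMr ?mulr_gt0// mul1r -natrM ler_nat.
Qed.

(** Each coordinate is rounded towards zero on the grid: absolute values do not grow, so the point
    stays in the net, and [d] errors of at most 1/(2 sqrt d) have squares adding up to at most
    1/4. *)
Lemma net_approx (x : 'cV[R]_d) : (0 < d)%N -> dotv x x <= 1 ->
  exists2 f, in_net f & dotv (x - net_point f) (x - net_point f) <= 4^-1.
Proof.
move=> d0 x1; have dR : 0 < d%:R :> R by rewrite ltr0n.
set s := Num.sqrt (d%:R : R).
have s0 : 0 < s by rewrite sqrtr_gt0.
have ss : s ^+ 2 = d%:R by rewrite sqr_sqrtr// ltW.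
pose y j := 2 * s * `|x j 0|.
have y0 j : 0 <= y j by rewrite !mulr_ge0// ltW.
have [tle tlt] : (forall j, (Num.truncn (y j))%:R <= y j) /\
    (forall j, y j < (Num.truncn (y j)).+1%:R).
  by split => j; have /andP[] := truncn_itv (y0 j).
have sumt : (\sum_j (Num.truncn (y j)) ^ 2 <= 4 * d)%N.
  rewrite -(ler_nat R) natr_sum natrM -ss.
  apply: (@le_trans _ _ (\sum_j (4 * s ^+ 2) * (x j 0 * x j 0))).
    apply: ler_sum => j _; rewrite natrX.
    have -> : 4 * s ^+ 2 * (x j 0 * x j 0) = y j ^+ 2.
      by rewrite /y !exprMn real_normK ?num_real//; ring.
    by rewrite lerXn2r// ?nnegrE.
  by rewrite -mulr_sumr ler_piMr// mulr_ge0// sqr_ge0.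
(* The ordinal range of [net_index] suffices: t^2 <= 4d <= (2d)^2. *)
have tm j : (Num.truncn (y j) < (2 * d).+1)%N.
  rewrite ltnS -leq_sqr; apply: leq_trans (leq_trans sumt _).
    by rewrite (bigD1 j)//= leq_addr.
  by rewrite expnMn -mulnn mulnA leq_pmulr.
pose f : net_index := [ffun j => (x j 0 < 0, inord (Num.truncn (y j)))].
exists f; first by rewrite /in_net; under eq_bigr do rewrite ffunE /= inordK//.
rewrite /dotv; apply: (@le_trans _ _ (\sum_(j < d) (4 * d%:R)^-1)); last first.
  rewrite sumr_const card_ord -[_ *+ d]mulr_natl invfM mulrCA mulfV ?mulr1//.
  exact: lt0r_neq0.
apply: ler_sum => j _; rewrite -expr2 -ss !mxE ffunE /= inordK// -/s.
have -> : x j 0 - (-1) ^+ (x j 0 < 0)%R * (Num.truncn (y j))%:R / (2 * s) =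
    (-1) ^+ (x j 0 < 0)%R * ((y j - (Num.truncn (y j))%:R) / (2 * s)).
  rewrite {1}[x j 0]realEsign ?num_real// -mulrA -mulrBr; congr (_ * _).
  by rewrite mulrBl; congr (_ - _); rewrite /y; field; exact: lt0r_neq0.
rewrite exprMn sqrr_sign mul1r.
rewrite expr_div_n ler_pdivrMr ?exprn_gt0 ?mulr_gt0//.
rewrite (_ : (4 * s ^+ 2)^-1 * (2 * s) ^+ 2 = 1); last by field; exact: lt0r_neq0.
rewrite expr_le1// ?subr_ge0 ?tle//.
by rewrite lerBlDr nat1r ltW.
Qed.

(** For [u] within 1/2 of x/|x|, Cauchy-Schwarz gives |x| - <x,u> <= |x|/2. *)
Lemma norm_le_net (x : 'cV[R]_d) : (0 < d)%N ->
  exists2 f, in_net f & dotv x x <= 4 * dotv x (net_point f) ^+ 2.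
Proof.
move=> d0; have [x0|x0] := eqVneq (dotv x x) 0.
  have [|f fN _] := net_approx 0 d0.
    by rewrite /dotv big1// => j _; rewrite mxE mul0r.
  by exists f => //; rewrite x0 mulr_ge0// sqr_ge0.
have xx : 0 < dotv x x by rewrite lt_neqAle eq_sym x0 dotv_ge0.
pose r := norm2 x; have r0 : 0 < r by rewrite sqrtr_gt0.
have r2 : r ^+ 2 = dotv x x by rewrite sqr_sqrtr// ltW.
have [|f fN fx] := net_approx (r^-1 *: x) d0.
  by rewrite dotvZr dotvZl -r2 expr2 mulKf ?mulVf// lt0r_neq0.
exists f => //; set u := net_point f in fx *.
have := dotv_cauchy_schwarz x (r^-1 *: x - u); rewrite dotvBr dotvZr -r2.
rewrite expr2 mulKf ?lt0r_neq0// => H.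
have {}H : (r - dotv x u) ^+ 2 <= (r / 2) ^+ 2.
  apply: le_trans H _; rewrite expr_div_n ler_pM2l ?mulr_gt0//.
  by rewrite -natrX.
have {}H : r - dotv x u <= r / 2.
  by rewrite leNgt; apply/negP => h; nra.
have : (r / 2) ^+ 2 <= dotv x u ^+ 2.
  by rewrite lerXn2r// ?nnegrE; lra.
rewrite expr_div_n; lra.
Qed.

Lemma quad_le_net n (X : 'I_n -> 'cV[R]_d) (m : R) : (0 < d)%N ->
  (forall f, in_net f -> \sum_i dotv (X i) (net_point f) ^+ 2 <= m) ->
  forall u, \sum_i dotv (X i) u ^+ 2 <= 4 * m * dotv u u.
Proof.
move=> d0 Xm; pose q u := \sum_i dotv (X i) u ^+ 2.
have q0 u : 0 <= q u by apply: sumr_ge0 => i _; exact: sqr_ge0.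
have qZ a u : q (a *: u) = a ^+ 2 * q u.
  by rewrite mulr_sumr; apply: eq_bigr => i _; rewrite dotvZr exprMn.
pose S := [set q u | u in [set u : 'cV[R]_d | dotv u u <= 1]].
(* Boundedness makes [sup S] a genuine upper bound rather than a default value; the absorption
   argument below needs it finite. *)
have ubS : has_ubound S.
  exists (\sum_i dotv (X i) (X i)) => _ [u /= u1 <-].
  apply: ler_sum => i _; apply: le_trans (dotv_cauchy_schwarz _ _) _.
  by rewrite ler_piMr// dotv_ge0.
have hS v : dotv v v <= 1 -> q v <= sup S.
  by move=> v1; apply: ub_le_sup => //; exists v.
have qv v : q v <= sup S * dotv v v.
  have [v0|v0] := eqVneq (dotv v v) 0.
    by rewrite v0 mulr0 (dotv_eq0 _ v0) -(scale0r 0) qZ expr0n mul0r.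
  have vv : 0 < dotv v v by rewrite lt_neqAle eq_sym v0 dotv_ge0.
  pose r := norm2 v; have r0 : 0 < r by rewrite sqrtr_gt0.
  have r2 : r ^+ 2 = dotv v v by rewrite sqr_sqrtr// ltW.
  rewrite -r2 -ler_pdivrMr ?exprn_gt0// mulrC -exprVn -qZ; apply: hS.
  by rewrite dotvZr dotvZl -r2 expr2 mulKf ?mulVf// lt0r_neq0.
have supS : sup S <= 4 * m.
  (* (a + b)^2 <= 2 a^2 + 2 b^2 with v = u + (v - u), where |v - u|^2 <= 1/4 *)
  suff : sup S <= 2 * m + sup S / 2 by lra.
  apply: sup_le_ub.
    by exists (q 0), 0 => //=; rewrite /dotv big1// => j _; rewrite mxE mul0r.
  move=> _ [v /= v1 <-]; have [f fN fv] := net_approx v d0 v1.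
  set u := net_point f in fv; have qu : q u <= m by exact: Xm.
  have := qv (v - u); have s0 : 0 <= sup S.
    by apply: le_trans (hS 0 _) => //; rewrite /dotv big1// => j _; rewrite mxE mul0r.
  have : q v <= 2 * q u + 2 * q (v - u).
    rewrite !mulr_sumr -big_split; apply: ler_sum => i _ /=; rewrite dotvBr.
    by have := sqr_ge0 (2 * dotv (X i) u - dotv (X i) v); nra.
  nra.
move=> u; apply: le_trans (qv u) _.
by rewrite ler_wpM2r// dotv_ge0.
Qed.

End net.

(** * Tail bounds *)

Section tails.
Context {R : realType} {dsp : measure_display} {T : measurableType dsp}.

(** The space is arbitrary so that the lemma also serves for [T] with the sigma-algebra generated by
    [cylinders]. *)
Lemma measurable_dotvl {dsp' : measure_display} {T' : measurableType dsp'} {d}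
    (x : T' -> 'cV[R]_d) (u : 'cV[R]_d) :
  (forall j, measurable_fun setT (fun w => x w j 0)) ->
  measurable_fun setT (fun w => dotv (x w) u).
Proof.
by move=> mx; apply: measurable_sum => j; apply: measurable_funM.
Qed.

Lemma measurable_dotv {dsp' : measure_display} {T' : measurableType dsp'} {d}
    (x : T' -> 'cV[R]_d) :
  (forall j, measurable_fun setT (fun w => x w j 0)) ->
  measurable_fun setT (fun w => dotv (x w) (x w)).
Proof.
by move=> mx; apply: measurable_sum => j; apply: measurable_funM.
Qed.

Variable P : probability T R.

(** The bad events are packed into one measurable set; their number is a sum of ones, to match
    [card_net]. *)
Lemma union_bound (I : finType) (Q : pred I) (F : I -> set T) (p : R) :
  (forall i, measurable (F i)) -> (forall i, Q i -> (P (F i) <= p%:E)%E) ->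
  exists A, [/\ measurable A, forall i, Q i -> F i `<=` A &
    (P A <= (p * \sum_(i | Q i) 1)%:E)%E].
Proof.
move=> mF FQ.
suff [A [mA FA PA]] : exists A, [/\ measurable A,
    forall i, i \in enum Q -> F i `<=` A &
    (P A <= (p * \sum_(i <- enum Q) 1)%:E)%E].
  exists A; split => //; first by move=> i Qi; apply: FA; rewrite mem_enum.
  by move: PA; rewrite big_enum.
have : forall i, i \in enum Q -> (P (F i) <= p%:E)%E.
  by move=> i; rewrite mem_enum => /FQ.
elim: (enum Q) => [_|i s IH FQs].
  by exists set0; split => //; rewrite big_nil mulr0 measure0.
have [|A [mA FA PA]] := IH.
  by move=> j js; apply: FQs; rewrite inE js orbT.
exists (F i `|` A); split; first exact: measurableU.
- move=> j; rewrite inE => /orP[/eqP ->|/FA jA]; first exact: subsetUl.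
  by apply: subset_trans jA _; exact: subsetUr.
- rewrite big_cons mulrDr mulr1 EFinD.
  apply: le_trans (measureU2 _ _ _) _ => //.
  by apply: leeD => //; apply: FQs; rewrite inE eqxx.
Qed.

(** Net points lie inside the ball rather than on the sphere; rescaling to norm 1 only increases the
    exponent. *)
Lemma subgaussian_unit_ball d (K : R) (x : T -> 'cV[R]_d) (u : 'cV[R]_d) :
  (forall j, measurable_fun setT (fun w => x w j 0)) ->
  subgaussian P K x -> dotv u u <= 1 ->
  (\int[P]_w (expR (dotv (x w) u ^+ 2 / K ^+ 2))%:E <= 2%:E)%E.
Proof.
move=> mx sx u1; have mE v :
    measurable_fun setT (EFin \o (fun w => expR (dotv (x w) v ^+ 2 / K ^+ 2))).
  apply/measurable_EFinP/measurableT_comp => //.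
  by apply: measurable_funM => //; apply: measurable_funX; exact: measurable_dotvl.
have [u0|u0] := eqVneq (dotv u u) 0.
  have xu0 w : dotv (x w) u = 0.
    by rewrite (dotv_eq0 _ u0) -(scale0r 0) dotvZr mul0r.
  under eq_integral do rewrite xu0 expr0n/= mul0r expR0.
  rewrite integral_cst// mul1e; apply: le_trans (probability_le1 P measurableT) _.
  by rewrite lee_fin ler1n.
have uu : 0 < dotv u u by rewrite lt_neqAle eq_sym u0 dotv_ge0.
pose r := norm2 u; have r0 : 0 < r by rewrite sqrtr_gt0.
have r2 : r ^+ 2 = dotv u u by rewrite sqr_sqrtr// ltW.
have v1 : norm2 (r^-1 *: u) = 1.
  by rewrite /norm2 dotvZr dotvZl -r2 expr2 mulKf ?mulVf ?sqrtr1// lt0r_neq0.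
apply: le_trans (sx _ v1); apply: ge0_le_integral => //.
- exact: mE.
- exact: mE.
- move=> w _; rewrite lee_fin ler_expR ler_wpM2r ?invr_ge0 ?sqr_ge0//.
  rewrite dotvZr exprMn exprVn r2 ler_peMl ?sqr_ge0//.
  by rewrite invf_ge1.
Qed.

(** By [norm_le_net] the exponential is at most its largest analogue over the net, hence at most the
    sum over the net, whose at most 64^d terms have mean at most 2. *)
Lemma subgaussian_sqnorm d (K : R) (x : T -> 'cV[R]_d) : (0 < d)%N -> 0 < K ->
  (forall j, measurable_fun setT (fun w => x w j 0)) ->
  subgaussian P K x ->
  (\int[P]_w (expR (dotv (x w) (x w) / (4 * K ^+ 2)))%:E <= (2 * 64 ^+ d)%:E)%E.
Proof.
move=> d0 K0 mx sx.
pose g (f : @net_index d) w := expR (dotv (x w) (net_point f) ^+ 2 / K ^+ 2).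
have mg f : measurable_fun setT (EFin \o g f).
  apply/measurable_EFinP/measurableT_comp => //.
  by apply: measurable_funM => //; apply: measurable_funX; exact: measurable_dotvl.
apply: (@le_trans _ _ (\int[P]_w (\sum_(f <- enum in_net) (g f w)%:E)))%E.
  apply: ge0_le_integral => //.
  - apply/measurable_EFinP/measurableT_comp => //.
    by apply: measurable_funM => //; exact: measurable_dotv.
  - by apply: emeasurable_sum => f; exact: mg.
  - move=> w _; rewrite sumEFin lee_fin.
    have [f fN fx] := norm_le_net (x w) d0.
    rewrite big_enum /= (bigD1 f)//= -[leLHS]addr0 lerD//; last first.
      by apply: sumr_ge0 => *; exact: expR_ge0.
    rewrite ler_expR invfM mulrA ler_wpM2r ?invr_ge0 ?sqr_ge0//.
    by rewrite ler_pdivrMr// mulrC.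
rewrite ge0_integral_sum//; last first.
  by move=> f w _; rewrite lee_fin expR_ge0.
rewrite big_enum /=.
apply: (@le_trans _ _ (\sum_(f : @net_index d | in_net f) 2%:E))%E.
  apply: lee_sum => f fN; apply: subgaussian_unit_ball => //.
  exact: net_point_le1.
rewrite sumEFin lee_fin -[X in \sum_(_ | _) X]mulr1 -mulr_sumr ler_wpM2l//.
exact: card_net.
Qed.

Lemma sum_dotv_tail d n (K t : R) (X : 'I_n -> T -> 'cV[R]_d) (u : 'cV[R]_d) :
  (forall i j, measurable_fun setT (fun w => X i w j 0)) ->
  mutually_indep P X -> (forall i, subgaussian P K (X i)) -> dotv u u <= 1 ->
  (P [set w | t < \sum_i dotv (X i w) u ^+ 2 / K ^+ 2]%R
    <= (2 ^+ n * expR (- t))%:E)%E.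
Proof.
move=> mX iX sX u1; apply: exp_markov.
  apply: measurable_sum => i; apply: measurable_funM => //.
  by apply: measurable_funX; exact: measurable_dotvl.
under eq_integral do rewrite expR_sum.
apply: (@integral_prod_mutually_indep_le _ _ _ P n d X) => //.
- move=> i; apply: measurableT_comp => //; apply: measurable_funM => //.
  apply: measurable_funX; apply: measurable_dotvl => j.
  exact: measurable_coord_cylinders.
- by move=> i; apply: subgaussian_unit_ball.
Qed.

(** At z = |x|^2/(4K^2) this is a truncated fourth power of the norm, up to a constant. The lower
    cut drops the vectors controlled by the second-moment form; the upper cut yields exponential
    moments. *)
Definition window_sq (a b z : R) : R := \1_(`]a, b]%classic : set R) z * z ^+ 2.

Lemma window_sq_ge0 a b z : 0 <= window_sq a b z.
Proof. by rewrite mulr_ge0// sqr_ge0. Qed.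

Lemma measurable_window_sq a b : measurable_fun setT (window_sq a b).
Proof. by apply: measurable_funM; [exact: measurable_indic|exact: measurable_funX]. Qed.

(** The upper cut gives lam z^2 <= z/2, so the exponential exceeds 1 by at most 32 lam e^(z/4)
    e^(z/2), and 3z/4 <= z - a because z > 4a. *)
Lemma expR_window_sq_le (a b lam z : R) : 0 < lam -> 0 <= a -> 2 * lam * b <= 1 ->
  expR (lam * window_sq (4 * a) b z) <= 1 + 32 * lam * expR (z - a).
Proof.
move=> lam0 a0 lamb; have e0 := expR_gt0 (z - a).
rewrite /window_sq indicE; have [/[!inE]/= |_] := boolP (_ \in _); last first.
  by rewrite mul0r mulr0 expR0 lerDl ?mulr_ge0// ltW.
rewrite in_itv/= mul1r => /andP[az zb].
have z0 : 0 < z by lra.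
set y := lam * z ^+ 2.
have y0 : 0 <= y by rewrite /y mulr_ge0 ?sqr_ge0 ?ltW.
have yz : y <= z / 2 by rewrite /y; nra.
have ey : expR y <= 1 + y * expR y.
  have := expR_ge1Dx (- y); rewrite expRN => H.
  have : (1 - y) * expR y <= (expR y)^-1 * expR y by rewrite ler_pM2r ?expR_gt0.
  by rewrite mulVf ?gt_eqF ?expR_gt0//; lra.
apply: le_trans ey _; rewrite lerD2l {1}/y [32 * _]mulrC -!(mulrA lam) ler_pM2l//.
(* The quadratic Taylor term at z/4 is z^2/32. *)
have z32 : z ^+ 2 <= 32 * expR (z / 4).
  have /(expR_ge1Dxn 1) : 0 <= z / 4 by rewrite divr_ge0// ltW.
  by rewrite (_ : 2`! = 2)%N// expr_div_n; lra.
apply: (@le_trans _ _ (32 * expR (z / 4) * expR (z / 2))).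
  by apply: ler_pM; rewrite ?sqr_ge0 ?expR_ge0 ?ler_expR.
by rewrite -mulrA -expRD ler_pM2l// ler_expR; lra.
Qed.

(** The lower cut at 4ld gains e^(-ld), which cancels the 64^d of [subgaussian_sqnorm]: each factor
    has mean at most 1 + 64 lam, whatever [d] is. *)
Lemma window_sq_tail d n (K l B lam t : R) (X : 'I_n -> T -> 'cV[R]_d) :
  (0 < d)%N -> 0 < K -> 0 <= l -> 64 <= expR l -> 0 < lam -> 2 * lam * B <= 1 ->
  (forall i j, measurable_fun setT (fun w => X i w j 0)) ->
  mutually_indep P X -> (forall i, subgaussian P K (X i)) ->
  (P [set w | t < \sum_i lam *
      window_sq (4 * (l * d%:R)) B (dotv (X i w) (X i w) / (4 * K ^+ 2))]%R
    <= (expR (64 * lam) ^+ n * expR (- t))%:E)%E.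
Proof.
move=> d0 K0 l0 hl lam0 lamB mX iX sX.
set Y := window_sq _ _.
have mY d' (T' : measurableType d') (x : T' -> 'cV[R]_d) :
    (forall j, measurable_fun setT (fun w => x w j 0)) ->
    measurable_fun setT (fun w => lam * Y (dotv (x w) (x w) / (4 * K ^+ 2))).
  move=> mx; apply: measurable_funM => //; apply: measurableT_comp.
    exact: measurable_window_sq.
  by apply: measurable_funM => //; exact: measurable_dotv.
apply: exp_markov; first by apply: measurable_sum => i; exact: mY.
under eq_integral do rewrite expR_sum.
apply: (@integral_prod_mutually_indep_le _ _ _ P n d X) => //.
- move=> i; apply: measurableT_comp => //; apply: mY => j.
  exact: measurable_coord_cylinders.
- move=> i; pose z w := dotv (X i w) (X i w) / (4 * K ^+ 2).
  have mz : measurable_fun setT z.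
    by apply: measurable_funM => //; exact: measurable_dotv.
  pose c := 32 * lam * expR (- (l * d%:R)).
  have c0 : 0 <= c by rewrite !mulr_ge0 ?expR_ge0// ltW.
  apply: (@le_trans _ _ (\int[P]_w (1%:E + c%:E * (expR (z w))%:E)))%E.
    apply: ge0_le_integral => //.
    - by apply/measurable_EFinP/measurableT_comp => //; exact: mY.
    - apply: emeasurable_funD => //; apply: measurable_funeM.
      by apply/measurable_EFinP/measurableT_comp.
    - move=> w _; rewrite -EFinM -EFinD lee_fin.
      apply: le_trans (expR_window_sq_le _ _ _ _ _ _ _) _ => //.
        by rewrite mulr_ge0.
      by rewrite expRD /c; lra.
  rewrite ge0_integralD//; last 2 first.
  - by move=> w _; rewrite -EFinM lee_fin mulr_ge0// expR_ge0.
  - by apply: measurable_funeM; apply/measurable_EFinP/measurableT_comp.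
  rewrite (_ : \int[P]_w 1%:E = 1)%E; last first.
    by rewrite integral_cst// mul1e; exact: probability_setT.
  rewrite ge0_integralZl//; last first.
    by apply/measurable_EFinP/measurableT_comp.
  apply: (@le_trans _ _ (1%:E + c%:E * (2 * 64 ^+ d)%:E))%E.
    by rewrite leeD2l// lee_wpmul2l//; exact: subgaussian_sqnorm.
  rewrite -EFinM -EFinD lee_fin; apply: le_trans (expR_ge1Dx _).
  rewrite lerD2l /c.
  have : expR (- (l * d%:R)) * 64 ^+ d <= 1.
    rewrite expRN mulrC ler_pdivrMr ?expR_gt0// mul1r expRM_natr.
    by rewrite lerXn2r// nnegrE ?expR_ge0.
  have := ltW lam0; nra.
Qed.

End tails.

(** * Deterministic bound on the good event, and conclusion *)

(** The short vectors contribute 16K^2 ld times 4K^2(ld + 2n), where d <= n is used, and the long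
    ones 16K^4 times the window sum. The cap [B] does not enter the constant, which is how the
    latter stays independent of [A]. *)
Lemma opnorm_kronv_le {R : realType} d n (K l B : R) (X : 'I_n -> 'cV[R]_d) :
  (0 < d)%N -> (d <= n)%N -> 0 < K -> 0 <= l ->
  (forall i, dotv (X i) (X i) / (4 * K ^+ 2) <= B) ->
  (forall f, in_net f ->
    \sum_i dotv (X i) (net_point f) ^+ 2 / K ^+ 2 <= l * d%:R + 2 * n%:R) ->
  \sum_i window_sq (4 * (l * d%:R)) B (dotv (X i) (X i) / (4 * K ^+ 2))
    <= 65 * n%:R * d%:R ->
  opnorm (\sum_i (kronv (X i) (X i) *m (kronv (X i) (X i))^T)) <=
    (64 * K ^+ 4 * l * (l + 2) + 16 * 65 * K ^+ 4) * n%:R * d%:R.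
Proof.
move=> d0 dn K0 l0 XB Xnet Xwin.
have dR : 0 < d%:R :> R by rewrite ltr0n.
have dnR : d%:R <= n%:R :> R by rewrite ler_nat.
have nR : 0 < n%:R :> R by apply: lt_le_trans dnR.
have K2 : 0 < K ^+ 2 by rewrite exprn_gt0.
have K4 : 0 < K ^+ 4 by rewrite exprn_gt0.
apply: opnorm_sum_outer_le.
  have h1 : 0 <= 64 * K ^+ 4 * l * (l + 2).
    by apply: mulr_ge0; [apply: mulr_ge0 => //; apply: mulr_ge0; lra|lra].
  by apply: mulr_gt0 => //; apply: mulr_gt0 => //; lra.
pose Z i := dotv (X i) (X i) / (4 * K ^+ 2).
pose Y i := window_sq (4 * (l * d%:R)) B (Z i).
pose m := K ^+ 2 * (l * d%:R + 2 * n%:R).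
have quad := quad_le_net n X m d0 _.
have {}quad u : \sum_i dotv (X i) u ^+ 2 <= 4 * m * dotv u u.
  apply: quad => f fN; have := Xnet f fN.
  by rewrite -mulr_suml ler_pdivrMr// mulrC.
have ZX i : dotv (X i) (X i) = 4 * K ^+ 2 * Z i.
  by rewrite /Z; field; rewrite gt_eqF.
have alpha0 : 0 <= 16 * K ^+ 2 * l * d%:R.
  by apply: mulr_ge0; [apply: mulr_ge0 => //; lra|lra].
have := quad_kronv_le X (4 * m) (16 * K ^+ 2 * l * d%:R)
  (fun i => 16 * K ^+ 4 * Y i) alpha0 _ quad.
move=> H U; apply: le_trans (H _ _ U) _.
- by move=> i; apply: mulr_ge0; [lra|exact: window_sq_ge0].
- move=> i; rewrite ZX => Zi.
  rewrite /Y /window_sq indicE mem_set.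
    by rewrite mul1r le_eqVlt; apply/orP; left; apply/eqP; ring.
  rewrite /= in_itv/= XB andbT.
  by rewrite -(ltr_pM2l K2); lra.
rewrite ler_wpM2r ?dotv_ge0// -mulr_sumr.
have h1 : K ^+ 4 * \sum_i Y i <= K ^+ 4 * (65 * n%:R * d%:R) by rewrite ler_pM2l.
have h2 : l * d%:R + 2 * n%:R <= (l + 2) * n%:R.
  have : l * d%:R <= l * n%:R by rewrite ler_wpM2l.
  lra.
have h3 : 64 * K ^+ 4 * l * d%:R * (l * d%:R + 2 * n%:R) <=
          64 * K ^+ 4 * l * d%:R * ((l + 2) * n%:R).
  rewrite ler_wpM2l//; apply: mulr_ge0; last exact: ltW.
  by apply: mulr_ge0 => //; lra.
have -> : 16 * K ^+ 2 * l * d%:R * (4 * m) =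
   64 * K ^+ 4 * l * d%:R * (l * d%:R + 2 * n%:R) by rewrite /m; ring.
lra.
Qed.

(** With x = ln n >= 12Q, the cubic Taylor term gives 2Qx^2 <= x^3/6 <= n, and all three claims
    follow from this. *)
Lemma sample_size_large {R : realType} (A l : R) (d n : nat) : 0 < A -> 0 <= l ->
  (0 < d)%N -> 12 * ((A + 1) * (l + A + 2)) <= ln (n%:R : R) ->
  [/\ 4 <= n%:R :> R, (A + 1) * ln n%:R <= n%:R &
      2 * (l * d%:R + (A + 2) * ln n%:R) * ((A + 1) * ln n%:R) <= n%:R * d%:R].
Proof.
move=> A0 l0 d0; set x := ln n%:R => x0.
set Q := (A + 1) * (l + A + 2) in x0.
have Q2 : 2 <= Q.
  apply: (@le_trans _ _ (1 * 2)); first by rewrite mul1r.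
  by apply: ler_pM; lra.
have x24 : 24 <= x by lra.
have n0 : 0 < n%:R :> R.
  by rewrite ltNge; apply/negP => /ln0; rewrite -/x => xE; lra.
have nE : expR x = n%:R by rewrite lnK.
have n3 : x ^+ 3 / 6 <= n%:R.
  have := expR_ge1Dxn 2 (_ : 0 <= x); rewrite nE (_ : 3`! = 6)%N//.
  by move=> H; have := H (le_trans _ x24); lra.
have d1 : 1 <= d%:R :> R by rewrite ler1n.
have x2 : 2 * Q * x ^+ 2 <= n%:R.
  rewrite (exprS x 2) mulrAC in n3; apply: le_trans n3; rewrite ler_wpM2r ?sqr_ge0//; lra.
have AQ : A + 1 <= Q by rewrite /Q ler_peMr; lra.
have xx : x <= x ^+ 2 by rewrite expr2 ler_peMr; lra.
have Qxx : 2 * Q * x <= 2 * Q * x ^+ 2 by rewrite ler_wpM2l//; lra.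
split.
- apply: le_trans x2; apply: le_trans Qxx.
  by apply: (@le_trans _ _ (4 * 1)); [rewrite mulr1|apply: ler_pM; lra].
- apply: le_trans x2; apply: le_trans Qxx.
  by rewrite ler_wpM2r; lra.
- have hB : l * d%:R + (A + 2) * x <= (l + A + 2) * x * d%:R.
    have h1 : l * d%:R <= l * x * d%:R by rewrite -mulrA ler_wpM2l// ler_peMl//; lra.
    have h2 : (A + 2) * x <= (A + 2) * x * d%:R by rewrite ler_peMr// mulr_ge0//; lra.
    lra.
  apply: (@le_trans _ _ (2 * Q * x ^+ 2 * d%:R)); last by rewrite ler_wpM2r.
  have -> : 2 * Q * x ^+ 2 * d%:R = 2 * ((l + A + 2) * x * d%:R) * ((A + 1) * x).
    by rewrite /Q; ring.
  by rewrite ler_wpM2r ?ler_wpM2l// mulr_ge0//; lra.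
Qed.

(** The probability 1 - n^(-omega(1)) is expressed by quantifiers: [C] is fixed before the exponent
    [A], and only the threshold [N] depends on [A]. A measurable [E] inside the event avoids proving
    the event itself measurable. *)
Theorem mainTheorem15 (R : realType) (K : R) (hK : 0 < K) :
  exists C0star : R, forall C0 : R, C0star <= C0 ->
  exists C : R, 0 < C /\
  forall A : R, 0 < A -> exists N : nat,
  forall (d n : nat), (1 <= d)%N -> (N <= n)%N ->
    d%:R * (ln d%:R) `^ C0 <= n%:R ->
  forall (dsp : measure_display) (T : measurableType dsp)
         (P : probability T R) (X : 'I_n -> T -> 'cV[R]_d),
    (forall i j, measurable_fun setT (fun w => X i w j 0)) ->
    mutually_indep P X ->
    ident_distr P X ->
    (forall i, mean_zero P (X i)) ->
    (forall i, subgaussian P K (X i)) ->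
    (forall i, opnorm (covmx P (X i)) <= 1) ->
    exists E : set T, measurable E /\
      E `<=` [set w | opnorm (\sum_(i < n)
                 (kronv (X i w) (X i w) *m (kronv (X i w) (X i w))^T))
               <= C * n%:R * d%:R] /\
      ((1 - (n%:R `^ (- A)))%:E <= P E)%E.
Proof.
pose l : R := ln 64.
have l0 : 0 <= l by rewrite ln_ge0// ler1n.
have el : expR l = 64 by rewrite lnK// posrE.
(* The growth condition enters through d <= n, for which a nonnegative exponent suffices. *)
exists 0 => C0 C0_ge0.
exists (64 * K ^+ 4 * l * (l + 2) + 16 * 65 * K ^+ 4); split.
  have K4 : 0 < K ^+ 4 by rewrite exprn_gt0.
  have h1 : 0 <= 64 * K ^+ 4 * l * (l + 2).
    by apply: mulr_ge0; [apply: mulr_ge0 => //; lra|lra].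
  by lra.
move=> A A0; pose x0 := 12 * ((A + 1) * (l + A + 2)).
exists (Num.truncn (expR x0)).+1 => d n d0 Nn dn dsp T P X mX iX _ _ sX _.
have x01 : 1 <= x0 by rewrite /x0; nra.
have n0 : expR x0 <= n%:R.
  by apply: le_trans (ltW (truncnS_gt _)) _; rewrite ler_nat.
have nR : 0 < n%:R :> R by apply: lt_le_trans n0; exact: expR_gt0.
have [n4 nA nB] : [/\ 4 <= n%:R :> R, (A + 1) * ln n%:R <= n%:R &
      2 * (l * d%:R + (A + 2) * ln n%:R) * ((A + 1) * ln n%:R) <= n%:R * d%:R].
  by apply: sample_size_large => //; rewrite -[leLHS]expRK ler_ln ?posrE// expR_gt0.
have dR : 0 < d%:R :> R by rewrite ltr0n.
(* Either ln d >= 1 and its power is at least 1, or d < e <= n. *)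
have d_le_n : (d <= n)%N.
  rewrite -(ler_nat R); have [d1|d1] := leP 1 (ln d%:R : R).
    apply: le_trans dn; rewrite ler_peMr//.
    by have := ler_powR d1 C0_ge0; rewrite powRr0.
  rewrite -[d%:R]lnK ?posrE//; apply: le_trans n0.
  by rewrite ler_expR; lra.
set x := ln n%:R in nA nB.
have nE : expR x = n%:R by rewrite lnK.
have xx0 : 1 <= x.
  by apply: le_trans x01 _; rewrite -[x0]expRK ler_ln ?posrE// expR_gt0.
(* Chosen so that 2 64^d e^(-B) = 2 n^(-(A+2)), which survives a union bound over [n] samples. *)
pose B := l * d%:R + (A + 2) * x.
have B0 : 0 < B by rewrite /B ltr_wpDl ?mulr_ge0// mulr_gt0//; lra.
pose lam := (2 * B)^-1.
have lam0 : 0 < lam by rewrite invr_gt0 mulr_gt0.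
have lamB : 2 * lam * B <= 1 by rewrite mulrAC mulfV// gt_eqF// mulr_gt0.
(* This is n^(-(A+1)); the spare factor [n] absorbs the total of four such terms. *)
pose p := expR (- ((A + 1) * x)).
have e64 : 64 ^+ d = expR (l * d%:R) by rewrite expRM_natr el.
pose Z i w := dotv (X i w) (X i w) / (4 * K ^+ 2).
have mZ i : measurable_fun setT (Z i).
  by apply: measurable_funM => //; exact: measurable_dotv.
pose F1 i := [set w | B < Z i w].
have [A1 [mA1 FA1 PA1]] : exists A1, [/\ measurable A1,
    forall i, xpredT i -> F1 i `<=` A1 &
    (P A1 <= (2 * expR (- ((A + 2) * x)) * \sum_(i < n | xpredT i) 1)%:E)%E].
  apply: union_bound => [i|i _]; first exact: measurable_superlevel.
  apply: le_trans (exp_markov P _ _ (2 * 64 ^+ d) (mZ i) _) _.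
    exact: subgaussian_sqnorm.
  by rewrite lee_fin e64 -mulrA -expRD /B opprD addNKr.
(* The term ld pays for the size of the net and 2n for the moment 2^n <= e^n, leaving e^(-n) <=
   [p]. *)
pose F2 f := [set w | l * d%:R + 2 * n%:R <
  \sum_i dotv (X i w) (net_point f) ^+ 2 / K ^+ 2].
have [A2 [mA2 FA2 PA2]] : exists A2, [/\ measurable A2,
    forall f, in_net f -> F2 f `<=` A2 &
    (P A2 <= (2 ^+ n * expR (- (l * d%:R + 2 * n%:R)) *
      \sum_(f : @net_index d | in_net f) 1)%:E)%E].
  apply: union_bound => [f|f fN].
    apply: measurable_superlevel; apply: measurable_sum => i; apply: measurable_funM => //.
    by apply: measurable_funX; exact: measurable_dotvl.
  by apply: sum_dotv_tail => //; exact: net_point_le1.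
(* The excess of 65 over the 64 in [window_sq_tail] leaves e^(-lam n d), at most [p] by [nB]. *)
pose A3 := [set w | 65 * lam * n%:R * d%:R <
  \sum_i lam * window_sq (4 * (l * d%:R)) B (Z i w)].
have mA3 : measurable A3.
  apply: measurable_superlevel; apply: measurable_sum => i; apply: measurable_funM => //.
  by apply: measurableT_comp => //; exact: measurable_window_sq.
have PA3 : (P A3 <= (expR (64 * lam) ^+ n * expR (- (65 * lam * n%:R * d%:R)))%:E)%E.
  by apply: window_sq_tail => //; rewrite el.
exists (~` (A1 `|` A2 `|` A3)); split; [|split].
- by apply: measurableC; do 2 apply: measurableU => //.
- move=> w wE /=; apply: (@opnorm_kronv_le _ _ _ _ _ B) => //.
  + move=> i; rewrite leNgt; apply/negP => Zi; apply: wE; left; left.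
    exact: FA1 Zi.
  + move=> f fN; rewrite leNgt; apply/negP => Zi; apply: wE; left; right.
    exact: FA2 Zi.
  + rewrite -(ler_pM2l lam0) mulr_sumr leNgt; apply/negP => Zi; apply: wE; right.
    by rewrite /A3 /= (_ : 65 * lam * _ * _ = lam * (65 * n%:R * d%:R))//; ring.
- have p1 : 2 * expR (- ((A + 2) * x)) * (\sum_(i < n | xpredT i) 1) <= 2 * p.
    rewrite sumr_const card_ord -nE -mulrA -expRD ler_pM2l// ler_expR.
    by lra.
  have p2 : 2 ^+ n * expR (- (l * d%:R + 2 * n%:R)) *
      (\sum_(f : @net_index d | in_net f) 1) <= p.
    apply: (@le_trans _ _ (expR n%:R * expR (- (l * d%:R + 2 * n%:R)) * 64 ^+ d)).
      apply: ler_pM; rewrite ?mulr_ge0 ?expR_ge0 ?exprn_ge0 ?sumr_ge0//.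
        rewrite ler_wpM2r ?expR_ge0// -[n%:R]mulr1 expRM_natl lerXn2r ?nnegrE ?expR_ge0//.
        exact: (expR_ge1Dx 1).
      exact: card_net.
    by rewrite e64 -!expRD ler_expR; lra.
  have p3 : expR (64 * lam) ^+ n * expR (- (65 * lam * n%:R * d%:R)) <= p.
    rewrite -expRM_natr -expRD ler_expR.
    have d1 : 1 <= d%:R :> R by rewrite ler1n.
    have h1 : lam * n%:R <= lam * n%:R * d%:R by rewrite ler_peMr// mulr_ge0 ?ltW.
    have h2 : (A + 1) * x <= lam * n%:R * d%:R.
      by rewrite -mulrA /lam [leRHS]mulrC ler_pdivlMr ?mulr_gt0// mulrC.
    lra.
  have p4 : 4 * p <= n%:R `^ (- A).
    rewrite /powR gt_eqF// -/x.
    have -> : - A * x = x + - ((A + 1) * x) by ring.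
    by rewrite expRD nE ler_pM2r// expR_gt0.
  rewrite probability_setC; last by do 2 apply: measurableU => //.
  have PU : (P (A1 `|` A2 `|` A3) <= (4 * p)%:E)%E.
    apply: le_trans (measureU2 _ _ _) _ => //; first exact: measurableU.
    have -> : 4 * p = 2 * p + p + p by ring.
    rewrite 2!EFinD; apply: leeD; last by apply: le_trans PA3 _; rewrite lee_fin.
    apply: le_trans (measureU2 _ _ _) _ => //.
    by apply: leeD; [apply: le_trans PA1 _|apply: le_trans PA2 _]; rewrite lee_fin.
  rewrite EFinB; apply: leeB => //.
  by apply: le_trans PU _; rewrite lee_fin.
Qed.
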